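(* Let $\min\{\mathbf{c}^{\top}x : \mathbf{A}x=\mathbf{b},\ x\ge 0\}$ be a type (A) interval linear program, with $\mathbf{A}=[\underline A,\overline A]\subseteq\mathbb{R}^{m\times n}$, $\mathbf{b}=[\underline b,\overline b]\subseteq\mathbb{R}^m$, $\mathbf{c}=[\underline c,\overline c]\subseteq\mathbb{R}^n$. Then $$\underline f(\mathbf{A},\mathbf{b},\mathbf{c})=\max\Bigl\{\min_{b\in\mathbf{b}} b^{\top}y \;:\; y\in\mathbb{R}^m,\ \forall A\in\mathbf{A}\ \forall c\in\mathbf{c}:\ A^{\top}y\le c\Bigr\}$$ if and only if the primal interval linear program is weakly feasible or the dual interval linear program is strongly feasible.
   Context: For real matrices $\underline{A}\le\overline{A}$ (entrywise), $\mathbf{A}=[\underline{A},\overline{A}]=\{A:\underline{A}\le A\le\overline{A}\}$; interval vectors are defined analogously. The type (A) interval linear program is the family of linear programs $\min\{c^{\top}x: Ax=b,\ x\ge 0\}$ over all scenarios $(A,b,c)$ with $A\in\mathbf{A}$, $b\in\mathbf{b}$, $c\in\mathbf{c}$. The dual interval linear program is the family of the duals $\max\{b^{\top}y: A^{\top}y\le c\}$ of these scenarios. An interval linear program (primal or dual) is weakly feasible if it is feasible for at least one scenario, and strongly feasible if it is feasible for every scenario (the feasible point may depend on the scenario). For a scenario, $f(A,b,c)\in\mathbb{R}\cup\{\pm\infty\}$ is the primal optimal value ($+\infty$ if infeasible, $-\infty$ if unbounded), and $$\underline f(\mathbf{A},\mathbf{b},\mathbf{c})=\inf\{f(A,b,c):A\in\mathbf{A},b\in\mathbf{b},c\in\mathbf{c}\}.$$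 The maximum is taken on the extended real axis: the maximum of a set is its supremum in $\mathbb{R}\cup\{\pm\infty\}$, with $\max\emptyset=-\infty$ and value $\infty$ if the set is unbounded above. *)

(* Defs.v *)
From mathcomp Require Import all_boot all_order all_algebra.
From mathcomp Require Import boolp classical_sets constructive_ereal reals ereal.
Set Implicit Arguments.
Unset Strict Implicit.
Unset Printing Implicit Defensive.
Import Order.TTheory GRing.Theory Num.Theory.
Local Open Scope classical_set_scope.
Local Open Scope ring_scope.

(* Entrywise order; the library puts no order on matrices. *)
Definition mxle (R : realType) (p q : nat) (A B : 'M[R]_(p, q)) : Prop :=
  forall i j, A i j <= B i j.

Definition mxitv (R : realType) (p q : nat) (lo up : 'M[R]_(p, q)) :
    set 'M[R]_(p, q) :=
  [set A | mxle lo A /\ mxle A up].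

Definition dotp (R : realType) (p : nat) (u v : 'cV[R]_p) : R :=
  (u^T *m v) ord0 ord0.

Definition primal_feas (R : realType) (m n : nat)
    (A : 'M[R]_(m, n)) (b : 'cV[R]_m) : set 'cV[R]_n :=
  [set x | A *m x = b /\ mxle 0 x].

Definition dual_feas (R : realType) (m n : nat)
    (A : 'M[R]_(m, n)) (c : 'cV[R]_n) : set 'cV[R]_m :=
  [set y | mxle (A^T *m y) c].

(* [ereal_inf set0 = +oo] and the infimum of a set of reals unbounded below is
   [-oo], which are the values of infeasible and unbounded programs. *)
Definition optval (R : realType) (m n : nat)
    (A : 'M[R]_(m, n)) (b : 'cV[R]_m) (c : 'cV[R]_n) : \bar R :=
  ereal_inf [set (dotp c x)%:E | x in primal_feas A b].

Section IntervalLP.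
Context (R : realType) (m n : nat).
Variables (Alo Aup : 'M[R]_(m, n)) (blo bup : 'cV[R]_m) (clo cup : 'cV[R]_n).

(* For [s = (A, b, c)]: [s.1.1 = A], [s.1.2 = b], [s.2 = c]. *)
Definition scenarios : set ('M[R]_(m, n) * 'cV[R]_m * 'cV[R]_n) :=
  mxitv Alo Aup `*` mxitv blo bup `*` mxitv clo cup.

Definition best_optval : \bar R :=
  ereal_inf [set optval s.1.1 s.1.2 s.2 | s in scenarios].

Definition primal_weakly_feasible : Prop :=
  exists s, scenarios s /\ primal_feas s.1.1 s.1.2 !=set0.

Definition dual_strongly_feasible : Prop :=
  forall s, scenarios s -> dual_feas s.1.1 s.2 !=set0.

(* One [y] serving all [A] and [c], unlike in [dual_strongly_feasible]. *)
Definition robust_dual_feas : set 'cV[R]_m :=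
  [set y | forall A c, mxitv Alo Aup A -> mxitv clo cup c -> dual_feas A c y].

(* Minimum of [b^T y] over a nonempty compact box, hence attained. *)
Definition worst_dual_obj (y : 'cV[R]_m) : \bar R :=
  ereal_inf [set (dotp b y)%:E | b in mxitv blo bup].

(* Maximum on the extended real axis: the supremum, [-oo] on the empty set. *)
Definition robust_dual_val : \bar R :=
  ereal_sup [set worst_dual_obj y | y in robust_dual_feas].

End IntervalLP.

(* Main.v *)
Require Import Defs.
From mathcomp Require Import all_boot all_order all_algebra.
From mathcomp Require Import boolp classical_sets constructive_ereal reals ereal.
From mathcomp Require Import ring lra.

(** The points x >= 0 that are feasible for some scenario are exactly the
    solutions of the single system Alo x <= bup, blo <= Aup x, x >= 0
    (Oettli and Prager's criterion for nonnegative x, [oettli_prager_ge0]), and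
    on them clo is the cheapest cost. So the best optimal value is the value of
    one linear program P.

    Its linear programming dual D maximises blo.u - bup.v over u, v >= 0 with
    Aup^T u - Alo^T v <= clo. A feasible pair (u, v) yields the robust vector
    y = u - v, whose worst objective over the box of right-hand sides is at
    least blo.u - bup.v ([multipliers_robust]). Conversely the value of a
    robust y is at most that of P, by weak duality in each scenario
    ([robust_le_best]). The claimed equality is thus strong duality between P
    and D, which fails exactly when both programs are infeasible and their
    values are +oo and -oo. It remains to match the two feasibility conditions:
    P is feasible iff the primal is weakly feasible, and D is feasible iff the
    dual is strongly feasible. For the nontrivial half of the latter
    ([strongly_feasible_robust]), the Farkas certificate of infeasibility of D
    is an x >= 0 with clo.x < 0, Alo x <= 0 <= Aup x; the Oettli-Prager
    criterion turns it into a matrix A of the interval with A x = 0, and then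
    the dual of the scenario with A and clo is infeasible.

    Strong duality is obtained from Farkas' lemma. If a real t is below the
    value of P, adding clo.x <= t to P makes it infeasible
    ([dual_certificate]); the multiplier s of this constraint is either
    positive, and scaling by 1/s gives a robust y of value at least t, or zero,
    and then the certificate is a ray of D with positive objective. Such a ray
    refutes P, and it lifts any point of D above t ([robust_above]). *)

Set Implicit Arguments.
Unset Strict Implicit.
Unset Printing Implicit Defensive.
Import Order.TTheory GRing.Theory Num.Theory.
Local Open Scope classical_set_scope.
Local Open Scope ring_scope.

(** * Entrywise order and scalar product *)

Section MatrixOrder.
Context (R : realType).

Lemma mxle_refl p q (A : 'M[R]_(p, q)) : mxle A A.
Proof. by []. Qed.

Lemma mxle_trans p q (B A C : 'M[R]_(p, q)) : mxle A B -> mxle B C -> mxle A C.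
Proof. by move=> AB BC i j; exact: le_trans (AB i j) (BC i j). Qed.

Lemma mxle_col_mx k1 k2 q (A C : 'M[R]_(k1, q)) (B D : 'M[R]_(k2, q)) :
  mxle (col_mx A B) (col_mx C D) <-> mxle A C /\ mxle B D.
Proof.
split=> [le_col|[AC BD] i j]; last first.
  by rewrite !mxE; case: split => k; [exact: AC | exact: BD].
split=> i j; first by have := le_col (lshift k2 i) j; rewrite !col_mxEu.
by have := le_col (rshift k1 i) j; rewrite !col_mxEd.
Qed.

Lemma mxle_row_mx p q1 q2 (A C : 'M[R]_(p, q1)) (B D : 'M[R]_(p, q2)) :
  mxle (row_mx A B) (row_mx C D) <-> mxle A C /\ mxle B D.
Proof.
split=> [le_row|[AC BD] i j]; last first.
  by rewrite !mxE; case: split => k; [exact: AC | exact: BD].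
split=> i j; first by have := le_row i (lshift q2 j); rewrite !row_mxEl.
by have := le_row i (rshift q1 j); rewrite !row_mxEr.
Qed.

Lemma row_mx_ge0 p q1 q2 (A : 'M[R]_(p, q1)) (B : 'M[R]_(p, q2)) :
  mxle 0 A -> mxle 0 B -> mxle 0 (row_mx A B).
Proof. by move=> A0 B0; rewrite -row_mx0; apply/mxle_row_mx. Qed.

Lemma mxle_mull p q r (A B : 'M[R]_(p, q)) (C : 'M[R]_(q, r)) :
  mxle 0 C -> mxle A B -> mxle (A *m C) (B *m C).
Proof.
move=> C0 AB i j; rewrite !mxE ler_sum// => k _.
by rewrite ler_wpM2r//; have := C0 k j; rewrite mxE.
Qed.

Lemma mxle_mulr p q r (A B : 'M[R]_(q, r)) (C : 'M[R]_(p, q)) :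
  mxle 0 C -> mxle A B -> mxle (C *m A) (C *m B).
Proof.
move=> C0 AB i j; rewrite !mxE ler_sum// => k _.
by rewrite ler_wpM2l//; have := C0 i k; rewrite mxE.
Qed.

Lemma mxle_tr p q (A B : 'M[R]_(p, q)) : mxle A B -> mxle A^T B^T.
Proof. by move=> AB i j; rewrite !mxE. Qed.

Lemma dotpE p (u v : 'cV[R]_p) : dotp u v = \sum_i u i 0 * v i 0.
Proof. by rewrite /dotp mxE; apply: eq_bigr => i _; rewrite mxE. Qed.

Lemma dotpC p (u v : 'cV[R]_p) : dotp u v = dotp v u.
Proof. by rewrite !dotpE; apply: eq_bigr => i _; rewrite mulrC. Qed.

Lemma dotpDr p (u v w : 'cV[R]_p) : dotp u (v + w) = dotp u v + dotp u w.
Proof. by rewrite /dotp mulmxDr mxE. Qed.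

Lemma dotpBr p (u v w : 'cV[R]_p) : dotp u (v - w) = dotp u v - dotp u w.
Proof. by rewrite /dotp mulmxBr !mxE. Qed.

Lemma dotpZr p a (u v : 'cV[R]_p) : dotp u (a *: v) = a * dotp u v.
Proof. by rewrite /dotp -scalemxAr mxE. Qed.

Lemma dotp0l p (u : 'cV[R]_p) : dotp 0 u = 0.
Proof. by rewrite /dotp trmx0 mul0mx mxE. Qed.

Lemma dotpNl p (u v : 'cV[R]_p) : dotp (- u) v = - dotp u v.
Proof. by rewrite /dotp linearN mulNmx mxE. Qed.

Lemma dotp_col_mx k1 k2 (u1 v1 : 'cV[R]_k1) (u2 v2 : 'cV[R]_k2) :
  dotp (col_mx u1 u2) (col_mx v1 v2) = dotp u1 v1 + dotp u2 v2.
Proof. by rewrite /dotp tr_col_mx mul_row_col mxE. Qed.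

Lemma dotp_adj p q (A : 'M[R]_(p, q)) x y :
  dotp (A *m x) y = dotp (A^T *m y) x.
Proof. by rewrite dotpC /dotp trmx_mul trmxK mulmxA. Qed.

Lemma ler_dotp p (u v w : 'cV[R]_p) :
  mxle 0 w -> mxle u v -> dotp u w <= dotp v w.
Proof.
by move=> w0 uv; rewrite /dotp; apply: mxle_mull => //; exact: mxle_tr.
Qed.

Lemma weak_duality m n (A : 'M[R]_(m, n)) b c x y :
  primal_feas A b x -> dual_feas A c y -> dotp b y <= dotp c x.
Proof. by move=> [<- x0] Ayc; rewrite dotp_adj; exact: ler_dotp. Qed.

End MatrixOrder.

(** * Farkas' lemma *)

Section Farkas.
Context (R : realType).

(** Bartl's algebraic proof, by induction on the number of rows. If the first
    row a cannot be dropped, some x0 has B x0 <= 0, b x0 > 0, hence a x0 > 0.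
    Composing everything with the projection P along x0 onto the kernel of a
    turns a into 0, so the induction hypothesis expresses b P by the rows of
    B P. Undoing the projection only adds a multiple of a, whose coefficient is
    nonnegative by the signs at x0. *)
Lemma farkas_cone k n (A : 'M[R]_(k, n)) (b : 'rV[R]_n) :
  (forall x : 'cV[R]_n, mxle (A *m x) 0 -> (b *m x) 0 0 <= 0) ->
  exists2 l : 'rV[R]_k, mxle 0 l & b = l *m A.
Proof.
elim: k A b => [|k IHk] A b Ab.
  exists 0 => //; apply/rowP => j; rewrite mul0mx [RHS]mxE.
  have b_le0 (x : 'cV[R]_n) : (b *m x) 0 0 <= 0 by apply: Ab; case.
  (* b is nonpositive at both signs of each basis vector, hence zero *)
  have bj (a : R) : (b *m (a *: delta_mx j 0 : 'cV[R]_n)) 0 0 = a * b 0 j.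
    by rewrite -scalemxAr -colE !mxE.
  have := b_le0 (1 *: delta_mx j 0); have := b_le0 (-1 *: delta_mx j 0).
  by rewrite !bj; lra.
rewrite -[A](@vsubmxK _ 1 k) in Ab *.
move: (usubmx _) (dsubmx _) Ab => a B Ab.
have [Bb|/existsNP[x0 /not_implyP[Bx0 /negP]]] :=
    pselect (forall x : 'cV[R]_n, mxle (B *m x) 0 -> (b *m x) 0 0 <= 0).
  have [l l0 ->] := IHk _ _ Bb.
  exists (row_mx 0 l : 'rV_(1 + k)).
    exact: (@row_mx_ge0 R 1 1 k 0 l (mxle_refl _) l0).
  by rewrite (@mul_row_col _ 1 1 k) mul0mx add0r.
rewrite -ltNge => bx0.
have col_le0 (x : 'cV[R]_n) :
    mxle (a *m x) 0 -> mxle (B *m x) 0 -> (b *m x) 0 0 <= 0.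
  move=> ax Bx; apply: Ab; rewrite (@mul_col_mx _ 1 k) -(@col_mx0 _ 1 k 1).
  by apply/(@mxle_col_mx R 1 k).
have ax0 : 0 < (a *m x0) 0 0.
  rewrite ltNge; apply/negP => ax0; move: bx0; rewrite ltNge col_le0//.
  by move=> i j; rewrite !ord1 [leRHS]mxE.
pose alpha := (a *m x0) 0 0; pose P := 1%:M - alpha^-1 *: (x0 *m a).
have aE : a *m x0 = alpha%:M by exact: mx11_scalar.
have aP : a *m P = 0.
  rewrite mulmxBr mulmx1 -scalemxAr mulmxA aE mul_scalar_mx scalerA.
  by rewrite mulVf ?gt_eqF// scale1r subrr.
have [|l l0 bP] := IHk (B *m P) (b *m P).
  move=> x; rewrite -!mulmxA; apply: col_le0.
  by rewrite mulmxA aP mul0mx; exact: mxle_refl.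
pose mu := alpha^-1 * ((b *m x0) 0 0 - (l *m B *m x0) 0 0).
have mu0 : 0 <= mu.
  rewrite mulr_ge0 ?invr_ge0 ?(ltW ax0)// subr_ge0 (le_trans _ (ltW bx0))//.
  by have := mxle_mulr l0 Bx0 0 0; rewrite mulmx0 mulmxA [leRHS]mxE.
exists (row_mx mu%:M l : 'rV_(1 + k)).
  apply: (@row_mx_ge0 R 1 1 k mu%:M l _ l0).
  by move=> i j; rewrite !ord1 !mxE eqxx.
rewrite (@mul_row_col _ 1 1 k) mul_scalar_mx.
move: bP; rewrite mulmxA !mulmxBr !mulmx1 -!scalemxAr !mulmxA.
rewrite [b *m x0]mx11_scalar [l *m B *m x0]mx11_scalar !mul_scalar_mx.
move=> /(canRL (subrK _)) ->.
by rewrite !scalerA /mu mulrBr scalerBl [RHS]addrC -addrA [- _ + _]addrC.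
Qed.

(** Homogenisation: with an extra coordinate t >= 0, infeasibility says that
    M x <= t d, x >= 0 force t <= 0, and [farkas_cone] applied to the functional
    t produces the certificate. *)
Lemma farkas_alternative k n (M : 'M[R]_(k, n)) (d : 'cV[R]_k) :
  (exists2 x : 'cV[R]_n, mxle 0 x & mxle (M *m x) d) \/
  (exists p : 'cV[R]_k, [/\ mxle 0 p, mxle 0 (M^T *m p) & dotp d p < 0]).
Proof.
have [|noM] := pselect (exists2 x : 'cV[R]_n, mxle 0 x & mxle (M *m x) d).
  by left.
right.
(* the three blocks of rows encode M x <= t d, x >= 0 and t >= 0 *)
pose N : 'M[R]_(k + (n + 1), n + 1) :=
  col_mx (row_mx M (- d)) (col_mx (row_mx (- 1%:M) 0) (row_mx 0 (- 1%:M))).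
have [z|l l0] := farkas_cone (A := N) (b := row_mx 0 1%:M).
  rewrite -[z]vsubmxK; move: (usubmx z) (dsubmx z) => x t.
  rewrite [t]mx11_scalar; move: (t 0 0) => {z}{}t.
  rewrite !mul_col_mx !mul_row_col !mul0mx add0r addr0 mul1mx !mulNmx !mul1mx.
  rewrite -!col_mx0 => /mxle_col_mx[Mx /mxle_col_mx[x0 t0]].
  rewrite add0r mxE eqxx mulr1n leNgt; apply/negP => t_gt0.
  apply: noM; exists (t^-1 *: x).
    move=> i j; have := x0 i j; rewrite !mxE oppr_le0 => xij.
    by rewrite mulr_ge0// invr_ge0 ltW.
  move=> i j; have := Mx i j; rewrite -scalemxAr mul_mx_scalar !mxE.
  by rewrite subr_le0 ler_pdivrMl.
rewrite -[l]hsubmxK -[rsubmx l]hsubmxK in l0 *.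
move: (lsubmx l) (lsubmx (rsubmx l)) (rsubmx (rsubmx l)) l0 => p w r.
rewrite -!row_mx0 => /mxle_row_mx[p0 /mxle_row_mx[w0 r0]].
rewrite !mul_row_col !mul_mx_row !mulmx0 !mulmxN !mulmx1 !add_row_mx.
rewrite !addr0 !add0r.
move=> /eq_row_mx[pM pd].
exists p^T; split.
- by rewrite -trmx0; exact: mxle_tr.
- rewrite -trmx_mul; have -> : p *m M = w by apply/eqP; rewrite -subr_eq0 -pM.
  by rewrite -trmx0; exact: mxle_tr.
- rewrite /dotp -trmx_mul mxE; have := congr1 (fun A : 'M[R]_1 => A 0 0) pd.
  by have := r0 0 0; rewrite 2!mxE [RHS]mxE !mxE /=; lra.
Qed.

End Farkas.

(** * Duality for interval programs *)

(** As A runs through its interval, row i of A x sweeps the segment from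
    (Alo x) i to (Aup x) i, because x >= 0. The hypotheses make this segment
    meet that of b i; the larger of the two lower ends is a common point, reached
    by interpolating row i between Alo and Aup. *)
Lemma oettli_prager_ge0 (R : realType) m n (Alo Aup : 'M[R]_(m, n))
    (blo bup : 'cV[R]_m) (x : 'cV[R]_n) :
  mxle Alo Aup -> mxle blo bup ->
  mxle 0 x -> mxle (Alo *m x) bup -> mxle blo (Aup *m x) ->
  exists A b, [/\ mxitv Alo Aup A, mxitv blo bup b & A *m x = b].
Proof.
move=> hA hb x0 Alox Aupx.
have lohi : mxle (Alo *m x) (Aup *m x) by exact: mxle_mull.
pose b : 'cV[R]_m := \col_i Num.max (blo i 0) ((Alo *m x) i 0).
have bE i : b i 0 = Num.max (blo i 0) ((Alo *m x) i 0) by rewrite mxE.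
have blob i : blo i 0 <= b i 0 by rewrite bE le_max lexx.
have lob i : (Alo *m x) i 0 <= b i 0 by rewrite bE le_max lexx orbT.
have bbup i : b i 0 <= bup i 0 by rewrite bE ge_max hb Alox.
have bhi i : b i 0 <= (Aup *m x) i 0 by rewrite bE ge_max Aupx lohi.
(* th i = 0 when the segment is a point, as division by 0 gives 0 *)
pose th i := (b i 0 - (Alo *m x) i 0) / ((Aup *m x) i 0 - (Alo *m x) i 0).
have th0 i : 0 <= th i by rewrite divr_ge0// subr_ge0.
have th1 i : th i <= 1.
  have := lohi i 0; rewrite le_eqVlt => /predU1P[eqi|lti].
    by rewrite /th eqi subrr invr0 mulr0.
  by rewrite ler_pdivrMr ?subr_gt0// mul1r lerB.
exists (\matrix_(i, j) (Alo i j + th i * (Aup i j - Alo i j))), b; split.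
- split=> i j; rewrite mxE; have := hA i j; have := th0 i; have := th1 i; nra.
- by split=> i j; rewrite ord1.
- apply/colP => i.
  transitivity ((Alo *m x) i 0 + th i * ((Aup *m x) i 0 - (Alo *m x) i 0)).
    rewrite !mxE -sumrB mulr_sumr -big_split; apply: eq_bigr => j _ /=.
    by rewrite !mxE; ring.
  have [eqi|neqi] := eqVneq ((Aup *m x) i 0) ((Alo *m x) i 0).
    by have := lob i; have := bhi i; rewrite eqi; lra.
  by rewrite /th divfK ?subr_eq0// addrC subrK.
Qed.

Section IntervalDuality.
Context (R : realType) (m n : nat).
Variables (Alo Aup : 'M[R]_(m, n)) (blo bup : 'cV[R]_m) (clo cup : 'cV[R]_n).
Hypotheses (hA : mxle Alo Aup) (hb : mxle blo bup) (hc : mxle clo cup).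

(** The positive part u meets the largest matrix and the smallest right-hand
    side, the negative part v the opposite ones. The cost is left free because
    the certificates below bound A^T y by a multiple of clo. *)
Lemma multipliers_robust (u v : 'cV[R]_m) (c : 'cV[R]_n) :
  mxle 0 u -> mxle 0 v -> mxle (Aup^T *m u - Alo^T *m v) c ->
  (forall A, mxitv Alo Aup A -> dual_feas A c (u - v)) /\
  (forall b, mxitv blo bup b -> dotp blo u - dotp bup v <= dotp b (u - v)).
Proof.
move=> u0 v0 uvc; split=> [A [loA Aup_]|b [lob bup_]].
  apply: mxle_trans uvc => i j; rewrite mulmxBr !mxE lerB//.
    by have := mxle_mull u0 (mxle_tr Aup_) i j; rewrite !mxE.
  by have := mxle_mull v0 (mxle_tr loA) i j; rewrite !mxE.
by rewrite dotpBr lerB// ler_dotp.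
Qed.

Lemma robust_dual_feasP (y : 'cV[R]_m) :
  robust_dual_feas Alo Aup clo cup y <->
  forall A, mxitv Alo Aup A -> dual_feas A clo y.
Proof.
split=> [yrob A AA|yclo A c AA [cloc _]]; last first.
  exact: mxle_trans (yclo A AA) cloc.
by apply: yrob => //; split => //; exact: mxle_refl.
Qed.

(** The uniform lower bound l is what allows adding a ray to y for all
    right-hand sides at once. *)
Lemma strongly_feasible_robust :
  dual_strongly_feasible Alo Aup blo bup clo cup ->
  exists (y : 'cV[R]_m) (l : R), robust_dual_feas Alo Aup clo cup y /\
    forall b, mxitv blo bup b -> l <= dotp b y.
Proof.
move=> strong.
have [[uv]|[x [x0]]] := farkas_alternative (row_mx Aup^T (- Alo^T)) clo.
  rewrite -[uv]vsubmxK mul_row_col mulNmx -col_mx0 => /mxle_col_mx[u0 v0] uvc.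
  have [yrob ylb] := multipliers_robust u0 v0 uvc.
  by eexists _, _; split; [apply/robust_dual_feasP; exact: yrob | exact: ylb].
rewrite tr_row_mx linearN /= !trmxK mul_col_mx mulNmx -col_mx0.
move=> /mxle_col_mx[Aupx Alox] cx0.
have Alox' : mxle (Alo *m x) 0.
  by move=> i j; have := Alox i j; rewrite !mxE oppr_ge0.
have [A [b [AA [b0 b0'] Axb]]] :=
  oettli_prager_ge0 hA (@mxle_refl R _ _ 0) x0 Alox' Aupx.
have {b b0 b0' Axb} Ax : A *m x = 0.
  by rewrite Axb; apply/matrixP => i j; apply/le_anti; rewrite b0 b0'.
have [|y yfeas] := strong (A, blo, clo).
  by split; [split => //|]; split => //; exact: mxle_refl.
have := weak_duality (conj Ax x0) yfeas.
by rewrite dotp0l leNgt cx0.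
Qed.

(** Farkas' lemma for the best-case program with the extra constraint
    clo.x <= t, whose multiplier is s. The gap e, uniform in b, makes y a ray of
    unbounded objective when s = 0. *)
Lemma dual_certificate (t : R) :
  (t%:E < best_optval Alo Aup blo bup clo cup)%E ->
  exists (s e : R) (y : 'cV[R]_m), [/\ 0 <= s, 0 < e,
    forall A, mxitv Alo Aup A -> dual_feas A (s *: clo) y &
    forall b, mxitv blo bup b -> s * t + e <= dotp b y].
Proof.
move=> t_lt.
pose M := col_mx (col_mx Alo (- Aup)) clo^T.
pose d := col_mx (col_mx bup (- blo)) t%:M.
have [[x x0]|[p [p0]]] := farkas_alternative M d.
  rewrite /M /d !mul_col_mx mulNmx => /mxle_col_mx[/mxle_col_mx[Alox Aupx] cx].
  have Aupx' : mxle blo (Aup *m x).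
    by move=> i j; have := Aupx i j; rewrite !mxE lerN2.
  have [A [b [AA bb Axb]]] := oettli_prager_ge0 hA hb x0 Alox Aupx'.
  suff : (best_optval Alo Aup blo bup clo cup <= t%:E)%E by rewrite leNgt t_lt.
  apply: (@le_trans _ _ (optval A b clo)).
    apply: ereal_inf_lbound; exists (A, b, clo) => //=.
    by split => //=; split => //; exact: mxle_refl.
  apply: (@le_trans _ _ (dotp clo x)%:E).
    by apply: ereal_inf_lbound; exists x.
  by rewrite lee_fin; have := cx 0 0; rewrite [leRHS]mxE eqxx.
rewrite -[p]vsubmxK -[usubmx p]vsubmxK in p0 *.
move: (usubmx (usubmx p)) (dsubmx (usubmx p)) (dsubmx p) p0 => v u s.
rewrite -!col_mx0 => /mxle_col_mx[/mxle_col_mx[v0 u0] s0].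
rewrite [s]mx11_scalar; have {s0} := s0 0 0; rewrite mxE.
move: (s 0 0) => {}s s0.
rewrite /M /d !tr_col_mx !mul_row_col !trmxK linearN /= mulNmx mul_mx_scalar.
rewrite !dotp_col_mx dotpNl => uvc duv.
have {}uvc : mxle (Aup^T *m u - Alo^T *m v) (s *: clo).
  by move=> i j; have := uvc i j; rewrite !mxE; lra.
have {}duv : s * t < dotp blo u - dotp bup v.
  move: duv; rewrite [dotp t%:M _]dotpE big_ord1 !mxE eqxx !mulr1n; lra.
have [yrob ylb] := multipliers_robust u0 v0 uvc.
exists s, (dotp blo u - dotp bup v - s * t), (u - v).
split; [exact: s0| |exact: yrob|].
  by rewrite subr_gt0.
by move=> b bb; rewrite addrC subrK; exact: ylb.
Qed.

(** For s = 0 the vector y satisfies A^T y <= 0 and b.y > 0 in every scenario,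
    which contradicts weak duality with cost 0 if some scenario has a feasible
    x. *)
Lemma robust_above (t : R) :
  primal_weakly_feasible Alo Aup blo bup clo cup \/
  dual_strongly_feasible Alo Aup blo bup clo cup ->
  (t%:E < best_optval Alo Aup blo bup clo cup)%E ->
  (t%:E <= robust_dual_val Alo Aup blo bup clo cup)%E.
Proof.
move=> weak_or_strong /dual_certificate[s [e [y [s0 e0 yfeas ylb]]]].
suff [z zfeas zlb] : exists2 z, robust_dual_feas Alo Aup clo cup z &
    forall b, mxitv blo bup b -> t <= dotp b z.
  apply: (@le_trans _ _ (worst_dual_obj blo bup z)).
    by apply: le_ereal_inf_tmp => _ [b bb <-]; rewrite lee_fin; exact: zlb.
  by apply: ereal_sup_ubound; exists z.
move: s0; rewrite le_eqVlt => /predU1P[s_eq0|s_gt0]; last first.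
  exists (s^-1 *: y).
    apply/robust_dual_feasP => A AA i j; have := yfeas A AA i j.
    by rewrite -scalemxAr !mxE ler_pdivrMl.
  move=> b bb; rewrite dotpZr ler_pdivlMl//.
  by apply: le_trans (ylb b bb); rewrite lerDl ltW.
subst s; move: yfeas ylb; rewrite scale0r mul0r add0r => yfeas ylb.
case: weak_or_strong => [[[[A b] c] /= [[[/= AA bb] _] [x xfeas]]]|strong].
  have := weak_duality xfeas (yfeas A AA); have := ylb b bb.
  by rewrite dotp0l; lra.
have [y0 [l [y0rob y0lb]]] := strongly_feasible_robust strong.
(* this multiple of the ray, which gains at least e per unit, covers t - l *)
have k0 : 0 <= `|t - l| / e by rewrite divr_ge0// ltW.
exists (y0 + (`|t - l| / e) *: y).
  apply/robust_dual_feasP => A AA i j.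
  have := (robust_dual_feasP y0).1 y0rob A AA i j.
  have := yfeas A AA i j; rewrite mulmxDr -scalemxAr !mxE => Ay0 Ay.
  by rewrite -[leRHS]addr0 lerD// mulr_ge0_le0.
move=> b bb; rewrite dotpDr dotpZr.
have : `|t - l| <= `|t - l| / e * dotp b y.
  by rewrite -mulrA ler_peMr// ler_pdivlMl// mulr1 ylb.
have := y0lb b bb; have := ler_norm (t - l); lra.
Qed.

Lemma robust_le_best :
  (robust_dual_val Alo Aup blo bup clo cup <=
   best_optval Alo Aup blo bup clo cup)%E.
Proof.
apply: ge_ereal_sup => _ [y yrob <-].
apply: le_ereal_inf_tmp => _ [[[A b] c] /= [[/= AA bb] cc] <-].
apply: le_ereal_inf_tmp => _ [x xfeas <-].
apply: (@le_trans _ _ (dotp b y)%:E).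
  by apply: ereal_inf_lbound; exists b.
by rewrite lee_fin; exact: weak_duality xfeas (yrob A c AA cc).
Qed.

End IntervalDuality.

Lemma lee_of_lt_fin (R : realType) (x y : \bar R) :
  (forall t : R, (t%:E < x)%E -> (t%:E <= y)%E) -> (x <= y)%E.
Proof.
case: x => [r| |] xy; last by rewrite leNye.
  apply/lee_subgt0Pr => e e0; rewrite -EFinB; apply: xy.
  by rewrite lte_fin gtrBl.
case: y xy => [s| |] xy //; last by have := xy 0 (ltry _).
by have := xy (s + 1) (ltry _); rewrite lee_fin gerDl ler10.
Qed.

Theorem theorem9 (R : realType) (m n : nat)
    (Alo Aup : 'M[R]_(m, n)) (blo bup : 'cV[R]_m) (clo cup : 'cV[R]_n)
    (hA : mxle Alo Aup) (hb : mxle blo bup) (hc : mxle clo cup) :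
  best_optval Alo Aup blo bup clo cup =
    robust_dual_val Alo Aup blo bup clo cup
  <->
  primal_weakly_feasible Alo Aup blo bup clo cup \/
  dual_strongly_feasible Alo Aup blo bup clo cup.
Proof.
split=> [best_eq|feas].
  have [|noweak] := pselect (primal_weakly_feasible Alo Aup blo bup clo cup).
    by left.
  right; have [robust0|/set0P[y yrob]] :=
      eqVneq (robust_dual_feas Alo Aup clo cup) set0.
    (* both programs infeasible: the two values would be +oo and -oo *)
    exfalso; move: best_eq.
    rewrite /robust_dual_val robust0 image_set0 ereal_sup0.
    suff -> : best_optval Alo Aup blo bup clo cup = +oo%E by [].
    apply/eqP; rewrite -leye_eq; apply: le_ereal_inf_tmp => _ [s ss <-].
    apply: le_ereal_inf_tmp => _ [x xfeas <-]; exfalso; apply: noweak.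
    by exists s; split => //; exists x.
  by move=> [[A b] c] /= [[/= AA bb] cc]; exists y; exact: yrob.
apply/eqP; rewrite eq_le robust_le_best andbT.
by apply: lee_of_lt_fin => t; exact: robust_above.
Qed.
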